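(* Let $\mathrm{CAL}$ be a calibration measure from $\{\ell_\alpha\text{-}\mathrm{ECE},\ \ell_\alpha\text{-}\mathrm{BinECE},\ \mathrm{smCal},\ \ell_\alpha\text{-}\underline{\mathrm{distCal}}\}$, where $\alpha\ge1$ is arbitrary. For every positive integer $T$, every $\boldsymbol r=(r_1,\ldots,r_T)\in[0,1]^T$ and every $\boldsymbol y\in\{0,1\}^T$, $$\mathrm{CAL}(\bar{\boldsymbol r},\boldsymbol y)\le\mathrm{CAL}(\boldsymbol r,\boldsymbol y),$$ where $\bar{\boldsymbol r}:=(\bar r,\ldots,\bar r)\in[0,1]^T$ with $\bar r:=\frac1T\sum_{t=1}^Tr_t$.
   Context: For $\boldsymbol r\in[0,1]^T$ and $\boldsymbol y\in\{0,1\}^T$, $\mathrm{CAL}(\boldsymbol r,\boldsymbol y):=\mathrm{CAL}(J_{\boldsymbol r,\boldsymbol y})$, where $J_{\boldsymbol r,\boldsymbol y}$ is the distribution of $(r_t,y_t)$ for $t$ uniform on $\{1,\ldots,T\}$. A distribution of $(v,y)\in[0,1]\times\{0,1\}$ is calibrated if $\mathbb E[y\mid v]=v$ almost surely. For a distribution $J$ of $(v,y)\in[0,1]\times\{0,1\}$ and $\alpha\ge1$: $\ell_\alpha\text{-}\mathrm{ECE}(J):=\mathbb E[|v-\hat v|^\alpha]$, where $\hat v:=\mathbb E_J[y\mid v]$. $\ell_\alpha\text{-}\mathrm{BinECE}(J):=\sum_{i=1}^k\Pr_J[v\in I_i]\cdot\big|\mathbb E_J[v-y\mid v\in I_i]\big|^\alpha$,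 where $\{I_i\}_{i=1}^k$ is a fixed (arbitrary) partition of the prediction space $[0,1]$ (terms with $\Pr_J[v\in I_i]=0$ are $0$). $\mathrm{smCal}(J):=\sup_{w\in W_1}\mathbb E_J[(v-y)w(v)]$, where $W_1$ is the family of $1$-Lipschitz functions $w:[0,1]\to[-1,1]$. $\ell_\alpha\text{-}\underline{\mathrm{distCal}}(J):=\inf_\Pi\mathbb E_\Pi[|u-v|^\alpha]$, the infimum being over joint distributions $\Pi$ of $(u,v,y)\in[0,1]\times[0,1]\times\{0,1\}$ such that $(v,y)$ has distribution $J$ and the distribution of $(u,y)$ is calibrated. *)

(* Defs.v *)
From HB Require Import structures.
From mathcomp Require Import all_boot all_order all_algebra.
From mathcomp Require Import all_classical all_reals all_analysis.
From mathcomp Require Import measurable_realfun.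

Set Implicit Arguments.
Unset Strict Implicit.
Unset Printing Implicit Defensive.

Import Order.TTheory GRing.Theory Num.Theory.
Import numFieldNormedType.Exports.

Local Open Scope classical_set_scope.
Local Open Scope ring_scope.

(* A distribution of (v, y) in [0, 1] x {0, 1} is a probability measure on
   R * bool carried by `[0, 1] `*` [set: bool]; y is read as the real number
   y%:R. *)

Section empirical.
Context {R : realType} {n : nat} (r : 'I_n.+1 -> R) (y : 'I_n.+1 -> bool).

(* The distribution of (r t, y t) for t uniform on the n.+1 indices. *)
Definition empirical (A : set (R * bool)) : \bar R :=
  ((n.+1%:R^-1)%:E * \sum_(t < n.+1) \d_(r t, y t) A)%E.

Let d_ (k : nat) : {measure set (R * bool) -> \bar R} :=
  \d_(r (inord k), y (inord k)).

Let invS_ge0 : 0 <= n.+1%:R^-1 :> R. Proof. by rewrite invr_ge0. Qed.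

Let empiricalE :
  empirical = mscale (NngNum invS_ge0) (msum d_ n.+1).
Proof.
apply/funext => A; rewrite /empirical /mscale/= /msum; congr *%E.
by apply: eq_bigr => t _; rewrite /d_ inord_val.
Qed.

Let empirical0 : empirical set0 = 0%E.
Proof. by rewrite empiricalE measure0. Qed.

Let empirical_ge0 A : (0 <= empirical A)%E.
Proof. by rewrite empiricalE. Qed.

Let empirical_sigma_additive : semi_sigma_additive empirical.
Proof. by rewrite empiricalE; exact: measure_semi_sigma_additive. Qed.

HB.instance Definition _ := isMeasure.Build _ _ _ empirical
  empirical0 empirical_ge0 empirical_sigma_additive.

Let empirical_setT : empirical setT = 1%E.
Proof.
rewrite /empirical (eq_bigr (fun=> 1%E)) => [|t _]; last by rewrite diracT.
by rewrite sumEFin sumr_const card_ord -EFinM mulVf// pnatr_eq0.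
Qed.

HB.instance Definition _ := Measure_isProbability.Build _ _ _
  empirical empirical_setT.

End empirical.

Section calibration.
Context {R : realType}.
Implicit Types (J : probability (R * bool)%type R) (alpha : R).

(* g(v) is a version of the conditional expectation E_J[y | v]. *)
Definition is_condexp J (g : R -> R) : Prop :=
  [/\ measurable_fun [set: R] g,
      J.-integrable [set: R * bool] (fun x => (g x.1)%:E) &
      forall A, measurable A ->
        (\int[J]_(x in fst @^-1` A) (g x.1)%:E =
         \int[J]_(x in fst @^-1` A) (x.2%:R)%:E)%E].

Lemma condexp_exists J : exists g, is_condexp J g.
Proof.
have mfst : measurable_fun [set: R * bool] fst by [].
have mf A : measurable A -> measurable (@fst R bool @^-1` A).
  by move=> mA; rewrite -[X in measurable X]setTI; exact: mfst.
pose D := [set x : R * bool | x.2].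
have mD : measurable D.
  rewrite -[X in measurable X]setTI.
  exact: (@measurable_snd _ _ R bool measurableT [set b | b]).
pose fstm : {mfun (R * bool)%type >-> R} :=
  HB.pack (@fst R bool) (isMeasurableFun.Build _ _ _ _ _ mfst).
pose mu := distribution J fstm.
pose nu0 A := J (@fst R bool @^-1` A `&` D).
have nu00 : nu0 set0 = 0%E by rewrite /nu0 preimage_set0 set0I measure0.
have nu0f A : measurable A -> nu0 A \is a fin_num.
  by move=> mA; apply: fin_num_measure; apply: measurableI => //; exact: mf.
have nu0s : semi_sigma_additive nu0.
  move=> F mF tF mUF.
  rewrite /nu0 preimage_bigcup setI_bigcupl.
  apply: measure_semi_sigma_additive.
  - by move=> i; apply: measurableI => //; exact: mf.
  - move=> i j _ _ [x [[Fi Dx] [Fj _]]].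
    by apply: (tF i j) => //; exists x.1.
  - by apply: bigcup_measurable => i _; apply: measurableI => //; exact: mf.
pose nu : {charge set R -> \bar R} :=
  HB.pack nu0 (isCharge.Build _ _ _ nu0 nu00 nu0f nu0s).
have numu : nu `<< mu.
  apply/null_content_dominatesP => A mA muA0; apply/eqP.
  rewrite eq_le; apply/andP; split; last exact: measure_ge0.
  rewrite -[leRHS]muA0; apply: le_measure; rewrite ?inE //.
  - by apply: measurableI => //; exact: mf.
  - exact: mf.
pose f := Radon_Nikodym nu mu.
have fE A : measurable A -> nu A = (\int[mu]_(x in A) (fine (f x))%:E)%E.
  move=> mA; rewrite (Radon_Nikodym_integral numu mA).
  by apply: eq_integral => x _; rewrite fineK// Radon_Nikodym_fin_num.
have fi : mu.-integrable setT (EFin \o (fine \o f)).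
  apply: eq_integrable (Radon_Nikodym_integrable numu) => // x _ /=.
  by rewrite fineK// Radon_Nikodym_fin_num.
have mff : measurable_fun setT (fine \o f).
  by apply/measurable_EFinP; exact: (measurable_int _ fi).
have gi : J.-integrable [set: R * bool] (fun x => (fine (f x.1))%:E).
  apply/integrableP; split.
    by apply/measurable_EFinP; exact: measurableT_comp mff mfst.
  have /integrableP[_] := fi.
  rewrite (@ge0_integral_distribution _ _ _ _ _ J fstm)//.
  by apply: measurableT_comp => //; exact/measurable_EFinP.
exists (fine \o f); split => // A mA.
transitivity (\int[mu]_(x in A) (fine (f x))%:E)%E.
  rewrite integral_pushforward//; first exact/measurable_EFinP.
  by apply: integrableS gi => //; exact: mf.
rewrite -fE// /nu/= /nu0 setIC -integral_indic//; last exact: mf.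
  apply: eq_integral => x _; rewrite indicE /D; congr ((_ %:R)%:E).
  by congr nat_of_bool; apply/idP/idP; rewrite inE.
Qed.

(* Any two versions agree almost surely, so the choice made here is immaterial
   in what follows. *)
Definition condexp J : R -> R := sval (cid (condexp_exists J)).

Lemma condexpP J : is_condexp J (condexp J).
Proof. exact: svalP (cid (condexp_exists J)). Qed.

Definition calibrated J : Prop := {ae J, forall x, condexp J x.1 = x.1}.

Definition ECE alpha J : \bar R :=
  'E_J[fun x => (`|x.1 - condexp J x.1| `^ alpha)%R]%E.

(* E_J[X | B]; it is 0 when J B = 0. *)
Definition event_condexp J (X : R * bool -> R) (B : set (R * bool)) : R :=
  fine (\int[J]_(x in B) (X x)%:E)%E / fine (J B).

(* The bins must be measurable for Pr_J[v \in I i] to make sense; empty bins are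
   allowed, they contribute 0. *)
Definition bins k (I : 'I_k -> set R) : Prop :=
  [/\ forall i, measurable (I i), trivIset [set: 'I_k] I &
      cover [set: 'I_k] I = `[0, 1]%classic].

Definition BinECE alpha k (I : 'I_k -> set R) J : \bar R :=
  (\sum_(i < k) J (fst @^-1` I i) *
     (`|event_condexp J (fun x => x.1 - x.2%:R) (fst @^-1` I i)| `^ alpha)%:E)%E.

(* Functions [0, 1] -> [-1, 1] are represented by functions on R of which only
   the values on [0, 1] matter. *)
Definition W1 : set (R -> R) :=
  [set w : R -> R | 1.-lipschitz_(`[0, 1]%classic : set R) w /\
                    {in `[0, 1], forall v, -1 <= w v <= 1}].

Definition smCal J : \bar R :=
  ereal_sup [set (\int[J]_(x in `[0%R, 1%R] `*` [set: bool])
                    ((x.1 - x.2%:R) * w x.1)%R%:E)%E | w in W1].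

End calibration.

Section distCal.
Context {R : realType}.
Implicit Types (J : probability (R * bool)%type R) (alpha : R).
Implicit Types (Pi : probability (R * R * bool)%type R).

(* A point of R * R * bool is ((u, v), y). *)
Definition proj_uy (x : R * R * bool) : R * bool := (x.1.1, x.2).
Definition proj_vy (x : R * R * bool) : R * bool := (x.1.2, x.2).

Lemma measurable_proj_uy : measurable_fun setT proj_uy.
Proof.
apply: measurable_fun_pair => //.
exact: measurableT_comp measurable_fst measurable_fst.
Qed.

Lemma measurable_proj_vy : measurable_fun setT proj_vy.
Proof.
apply: measurable_fun_pair => //.
exact: measurableT_comp measurable_snd measurable_fst.
Qed.

HB.instance Definition _ :=
  isMeasurableFun.Build _ _ _ _ proj_uy measurable_proj_uy.
HB.instance Definition _ :=
  isMeasurableFun.Build _ _ _ _ proj_vy measurable_proj_vy.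

Definition calibrated_coupling J : set (probability (R * R * bool)%type R) :=
  [set Pi : probability (R * R * bool)%type R |
             [/\ Pi ((`[0%R, 1%R] `*` `[0%R, 1%R]) `*` [set: bool]) = 1%E,
                forall A, measurable A -> distribution Pi proj_vy A = J A &
                calibrated (distribution Pi proj_uy)]].

Definition low_distCal alpha J : \bar R :=
  ereal_inf [set 'E_Pi[fun x => (`|x.1.1 - x.1.2| `^ alpha)%R]%E
            | Pi in calibrated_coupling J].

End distCal.

Inductive calibration_measure (R : realType) :
    (probability (R * bool)%type R -> \bar R) -> Prop :=
| calibration_ECE (alpha : R) of 1 <= alpha :
    calibration_measure (ECE alpha)
| calibration_BinECE (alpha : R) (k : nat) (I : 'I_k -> set R)
    of 1 <= alpha & bins I :
    calibration_measure (BinECE alpha I)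
| calibration_smCal :
    calibration_measure (@smCal R)
| calibration_low_distCal (alpha : R) of 1 <= alpha :
    calibration_measure (low_distCal alpha).

(* Main.v *)
Require Import Defs.
From HB Require Import structures.
From mathcomp Require Import all_boot all_order all_algebra.
From mathcomp Require Import all_classical all_reals all_analysis.
From mathcomp Require Import measurable_realfun ring lra.

Set Implicit Arguments.
Unset Strict Implicit.
Unset Printing Implicit Defensive.

Import Order.TTheory GRing.Theory Num.Theory.
Import numFieldNormedType.Exports.

Local Open Scope classical_set_scope.
Local Open Scope ring_scope.

(** Let [d = |mean r - mean y|]. Under the constant prediction [mean r] every
    measure is at most [d ^ alpha] (at most [d] for smCal): the conditional
    expectation of [y] is [mean y], exactly one bin is charged, and for
    distCal the constant [u = mean y] is a calibrated coupling. Conversely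
    [d ^ alpha] bounds every measure from below: by Jensen's inequality
    [E |v - u| ^ alpha >= |E v - E u| ^ alpha], where [E u = E y] for [u] the
    conditional expectation of [y] or any calibrated [u]; BinECE is the same
    inequality averaged over the bins, and smCal is tested on [w = 1] and
    [w = -1]. *)

(** * Jensen's inequality for the power [alpha] *)

(** Supporting line of the convex power at [c], with slope the derivative [alpha * c ^ (alpha - 1)].
    For [alpha > 1] it is Young's inequality for [x] and [c ^ (alpha - 1)] with exponents [alpha]
    and [alpha / (alpha - 1)]. *)
Lemma powR_tangent (R : realType) (alpha c : R) : 1 <= alpha -> 0 <= c ->
  exists2 k, 0 <= k &
    forall x, 0 <= x -> c `^ alpha + k * (x - c) <= x `^ alpha.
Proof.
rewrite le_eqVlt => /predU1P[<-|alpha1] c0.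
  by exists 1 => // x x0; rewrite !powRr1//; lra.
have alpha0 : 0 < alpha by lra.
exists (alpha * c `^ (alpha - 1)) => [|x x0].
  by rewrite mulr_ge0 ?powR_ge0// ltW.
have q0 : 0 < alpha / (alpha - 1) by rewrite divr_gt0//; lra.
have := conjugate_powR x0 (powR_ge0 c (alpha - 1)) alpha0 q0.
have -> : c `^ (alpha - 1) `^ (alpha / (alpha - 1)) = c `^ alpha.
  by rewrite -powRrM mulrCA divff ?mulr1//; lra.
have alphaB1 : alpha - 1 != 0 by lra.
have alphaN0 : alpha != 0 by lra.
have -> : alpha^-1 + (alpha / (alpha - 1))^-1 = 1 by field; apply/andP.
move=> /(_ erefl); rewrite -(ler_pM2l alpha0).
have -> : alpha * (x `^ alpha / alpha + c `^ alpha / (alpha / (alpha - 1))) =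
    x `^ alpha + c `^ alpha * (alpha - 1) by field; apply/andP.
have -> : c `^ alpha = c * c `^ (alpha - 1).
  (* Valid at [c = 0] too: the exponents [1] and [alpha - 1] add up to [alpha], which is nonzero. *)
  rewrite -{2}(powRr1 c0) -powRD; first by congr powR; ring.
  by rewrite addrC subrK (negbTE alphaN0).
by move=> H; nra.
Qed.

(** Integrate the supporting line at [c] along [|X|]: its linear part has expectation
    [k * (E|X| - c)], nonnegative because [k >= 0] and [|E X| <= E|X|]. *)
Lemma powR_norm_expectation_le d (T : measurableType d) (R : realType)
    (P : probability T R) (X : T -> R) (alpha : R) : 1 <= alpha ->
    P.-integrable setT (EFin \o X) ->
  ((`|fine ('E_P[X])| `^ alpha)%R%:E <= 'E_P[fun x => (`|X x| `^ alpha)%R])%E.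
Proof.
move=> alpha1 iX.
set c := `|fine 'E_P[X]|.
have [k k0 tangent] := powR_tangent alpha1 (normr_ge0 _ : 0 <= c).
have mX : measurable_fun setT X by apply/measurable_EFinP/measurable_int/iX.
have mN : measurable_fun setT (fun x => `|X x|) by exact: measurableT_comp.
have mp : measurable_fun setT (fun x => `|X x| `^ alpha).
  exact: measurableT_comp (measurable_powR _) mN.
have cE : (c%:E <= \int[P]_x (`|X x|%R)%:E)%E.
  rewrite /c unlock -abse_EFin fineK; last exact: integrable_fin_num.
  by apply: le_abse_integral => //; exact: measurable_int iX.
(* Adding [k * c] makes both integrands nonnegative, so that the right-hand
   side may be infinite. *)
rewrite unlock -(@leeD2rE _ (k * c)%R%:E)//.
have -> : (\int[P]_x (`|X x| `^ alpha)%R%:E + (k * c)%R%:E =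
    \int[P]_x ((`|X x| `^ alpha)%R%:E + (k * c)%R%:E))%E.
  rewrite ge0_integralD//; last 2 first.
  - exact/measurable_EFinP.
  - by move=> x _; rewrite lee_fin mulr_ge0 ?normr_ge0.
  by rewrite integral_cst//= probability_setT mule1.
apply: (@le_trans _ _ (\int[P]_x ((c `^ alpha)%R%:E + k%:E * (`|X x|%R)%:E))%E).
  rewrite ge0_integralD//.
  - rewrite integral_cst//= probability_setT mule1 leeD2l// ge0_integralZl_EFin//.
      by rewrite EFinM lee_wpmul2l.
    exact/measurable_EFinP.
  - by move=> x _; rewrite lee_fin powR_ge0.
  - by move=> x _; rewrite mule_ge0.
  - by apply: measurable_funeM; exact/measurable_EFinP.
apply: ge0_le_integral => //.
- by move=> x _; rewrite adde_ge0 ?mule_ge0// lee_fin powR_ge0.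
- by apply: emeasurable_funD => //; apply: measurable_funeM; exact/measurable_EFinP.
- by apply: emeasurable_funD => //; exact/measurable_EFinP.
- move=> x _; rewrite -EFinM -!EFinD lee_fin.
  by have := tangent _ (normr_ge0 (X x)); lra.
Qed.

(** * Integrals against an empirical distribution *)

Section empirical_integral.
Context {R : realType} {n : nat} (r : 'I_n.+1 -> R) (y : 'I_n.+1 -> bool).
Implicit Types (D : set (R * bool)) (f : R * bool -> R).

Lemma ge0_integral_empirical D (f : R * bool -> \bar R) : measurable D ->
    measurable_fun D f -> (forall x, D x -> (0 <= f x)%E) ->
  (\int[empirical r y]_(x in D) f x =
   (n.+1%:R^-1)%:E * \sum_(t < n.+1) \d_(r t, y t) D * f (r t, y t))%E.
Proof.
move=> mD mf f0.
(* [msum] sums over natural indices, hence the detour through [inord]. *)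
pose d_ (k : nat) : {measure set (R * bool) -> \bar R} :=
  \d_(r (inord k), y (inord k)).
have n0 : 0 <= n.+1%:R^-1 :> R by rewrite invr_ge0.
rewrite (eq_measure_integral (mscale (NngNum n0) (msum d_ n.+1))); last first.
  move=> A _ _; rewrite /mscale/= /msum /empirical; congr (_ * _)%E.
  by apply: eq_bigr => t _; rewrite /d_ inord_val.
rewrite ge0_integral_mscale// ge0_integral_measure_sum//; congr (_ * _)%E.
by apply: eq_bigr => t _; rewrite /d_ inord_val integral_dirac.
Qed.

(** The positive and negative parts integrate to finite sums, which recombine through
    [max f 0 - max (- f) 0 = f]. *)
Lemma integral_empirical D f : measurable D -> measurable_fun D f ->
  (\int[empirical r y]_(x in D) (f x)%:E =
   (n.+1%:R^-1 * \sum_(t < n.+1) \1_D (r t, y t) * f (r t, y t))%R%:E)%E.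
Proof.
move=> mD mf; have mEf : measurable_fun D (EFin \o f) by exact/measurable_EFinP.
rewrite integralE (ge0_integral_empirical mD (measurable_funepos mEf))//.
rewrite (ge0_integral_empirical mD (measurable_funeneg mEf))//.
rewrite (eq_bigr (fun t => (\1_D (r t, y t) * Num.max (f (r t, y t)) 0)%:E)).
  rewrite [X in (_ - _ * X)%E](eq_bigr
    (fun t => (\1_D (r t, y t) * Num.max (- f (r t, y t)) 0)%:E)).
    rewrite !sumEFin -!EFinM -EFinB -mulrBr -sumrB; congr (_ * _)%:E.
    apply: eq_bigr => t _; rewrite -mulrBr; congr (_ * _).
    by rewrite !maxEle; case: ifPn; case: ifPn; lra.
  by move=> t _; rewrite funenegE EFinM EFin_max.
by move=> t _; rewrite funeposE EFinM EFin_max.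
Qed.

Lemma integrable_empirical f : measurable_fun setT f ->
  (empirical r y).-integrable setT (EFin \o f).
Proof.
move=> mf; apply/integrableP; split; first exact/measurable_EFinP.
rewrite (_ : (fun _ => _) = EFin \o (fun x => `|f x|))//.
by rewrite integral_empirical ?ltry//; exact: measurableT_comp.
Qed.

Lemma integralT_empirical f : measurable_fun setT f ->
  (\int[empirical r y]_x (f x)%:E =
   (n.+1%:R^-1 * \sum_(t < n.+1) f (r t, y t))%R%:E)%E.
Proof.
move=> mf; rewrite integral_empirical//.
by under eq_bigr do rewrite indicT mul1r.
Qed.

End empirical_integral.

(** * Labels as reals, and integrals under image measures *)

Lemma measurable_label d (T : measurableType d) (R : realType) (b : T -> bool) :
  measurable_fun setT b -> measurable_fun setT (fun x => (b x)%:R : R).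
Proof.
move=> mb; rewrite (_ : (fun _ => _) = (fun x => if b x then 1 else 0)).
  exact: measurable_fun_ifT.
by apply/funext => x; case: (b x).
Qed.

Section distribution_EFin.
Context {d d' : measure_display} {T : measurableType d}
  {T' : measurableType d'} {R : realType}
  (P : probability T R) (X : {mfun T >-> T'}) (f : T' -> R)
  (mf : measurable_fun setT f)
  (fi : (distribution P X).-integrable setT (EFin \o f)).

(** Change of variables for the nonnegative function [|f|] carries finiteness back to [P]. *)
Lemma integrable_distribution : P.-integrable setT (EFin \o (f \o X)).
Proof.
have /integrableP[mEf] := fi; rewrite ge0_integral_distribution//; last first.
  exact: measurableT_comp.
move=> foo; apply/integrableP; split => //.
by apply/measurable_EFinP; exact: measurableT_comp.
Qed.

Lemma integral_distribution_EFin :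
  (\int[P]_x (f (X x))%:E = \int[distribution P X]_x (f x)%:E)%E.
Proof.
rewrite (@integral_distribution _ _ _ _ _ P X (EFin \o f))//.
  exact/measurable_EFinP.
exact: integrable_distribution.
Qed.

End distribution_EFin.

(** * Sample means and conditional expectations *)

Section expectations.
Context {R : realType} {n : nat}.
Implicit Types (r : 'I_n.+1 -> R) (y : 'I_n.+1 -> bool) (a : R).

Definition mean (F : 'I_n.+1 -> R) : R := n.+1%:R^-1 * \sum_(t < n.+1) F t.

Definition meanb y : R := mean (fun t => (y t)%:R).

Lemma mean_cst a : mean (fun=> a) = a.
Proof. by rewrite /mean sumr_const card_ord -[a *+ _]mulr_natl mulKf. Qed.

Lemma empirical_full r y (A : set (R * bool)) :
  (forall t, A (r t, y t)) -> empirical r y A = 1%E.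
Proof.
move=> Ary; rewrite /empirical (eq_bigr (fun=> 1%E)) => [|t _].
  by rewrite sumEFin -EFinM -/(mean (fun=> 1)) mean_cst.
by rewrite diracE mem_set.
Qed.

Lemma meanB F G : mean (fun t => F t - G t) = mean F - mean G.
Proof. by rewrite /mean sumrB mulrBr. Qed.

Lemma meanMr F a : mean (fun t => F t * a) = mean F * a.
Proof. by rewrite /mean -mulr_suml mulrA. Qed.

(** The defining property of [condexp] on the whole space. Agreement on measurable sets, rather than
    equality of measures, lets [J] be a marginal of a coupling. *)
Lemma condexp_mean (J : probability (R * bool)%type R) r y :
    (forall A, measurable A -> J A = empirical r y A) ->
  mean (fun t => condexp J (r t)) = meanb y.
Proof.
move=> JE; have [mg _ /(_ setT measurableT)] := condexpP J.
have intJ f : (\int[J]_x f x = \int[empirical r y]_x f x)%E.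
  by apply: eq_measure_integral => A mA _; exact: JE.
rewrite preimage_setT !intJ.
rewrite !integralT_empirical; last 2 first.
- exact: measurable_label.
- exact: measurableT_comp mg measurable_fst.
by case.
Qed.

(** The point [a] carries all the mass of [v], so every version of the conditional expectation takes
    the same value there. *)
Lemma condexp_cst (J : probability (R * bool)%type R) a y :
    (forall A, measurable A -> J A = empirical (fun=> a) y A) ->
  condexp J a = meanb y.
Proof. by move=> /condexp_mean <-; rewrite mean_cst. Qed.

(** * Expected calibration error *)

Lemma ECE_cst alpha a y :
  ECE alpha (empirical (fun=> a) y) = (`|a - meanb y| `^ alpha)%:E.
Proof.
rewrite /ECE unlock integralT_empirical/=; last first.
  apply: measurableT_comp (measurable_powR _) _; apply: measurableT_comp => //.
  apply: measurable_funB => //.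
  case: (condexpP (empirical (fun=> a) y)) => mg _ _.
  exact: measurableT_comp mg measurable_fst.
by rewrite -/(mean (fun=> _)) mean_cst (@condexp_cst _ a y).
Qed.

Lemma ECE_ge alpha r y : 1 <= alpha ->
  ((`|mean r - meanb y| `^ alpha)%:E <= ECE alpha (empirical r y))%E.
Proof.
move=> alpha1.
have mX : measurable_fun setT
    (fun x : R * bool => x.1 - condexp (empirical r y) x.1).
  apply: measurable_funB => //.
  case: (condexpP (empirical r y)) => mg _ _.
  exact: measurableT_comp mg measurable_fst.
have := powR_norm_expectation_le alpha1 (integrable_empirical r y mX).
apply: le_trans; rewrite unlock integralT_empirical//= -/(mean (fun t => _ - _)).
by rewrite meanB (@condexp_mean _ r y).
Qed.

(** * Binned calibration error *)

(** Covering gives a bin containing [a] and disjointness makes it the only one. This partition of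
    unity turns sums over bins into plain means. *)
Lemma sum_bins_indic k (I : 'I_k -> set R) a : bins I -> 0 <= a <= 1 ->
  \sum_(i < k) \1_(I i) a = 1 :> R.
Proof.
move=> [mI tI cI] a01.
have : (cover [set: 'I_k] I) a by rewrite cI /= in_itv.
move=> [i _ Iia]; rewrite (bigD1 i)//= indicE mem_set// big1 ?addr0// => j ji.
rewrite indicE memNset// => Ija.
by move/eqP: ji; apply; apply: (tI j i) => //; exists a.
Qed.

(** These are [Pr[v in B]] and [E[(v - y) 1_B(v)]]; the latter is left unnormalised so that it adds
    up over the bins. *)
Definition bin_mass r (B : set R) := mean (fun t => \1_B (r t)).
Definition bin_error r y (B : set R) :=
  mean (fun t => \1_B (r t) * (r t - (y t)%:R)).

Lemma BinECE_empirical alpha k (I : 'I_k -> set R) r y : bins I ->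
  BinECE alpha I (empirical r y) =
  (\sum_(i < k) bin_mass r (I i) *
     `|bin_error r y (I i) / bin_mass r (I i)| `^ alpha)%R%:E.
Proof.
move=> [mI _ _]; rewrite /BinECE -sumEFin; apply: eq_bigr => i _.
have mB : measurable (@fst R bool @^-1` I i).
  by rewrite -[X in measurable X]setTI; exact: measurable_fst.
have pE : empirical r y (@fst R bool @^-1` I i) = (bin_mass r (I i))%:E.
  by rewrite /empirical /bin_mass /mean EFinM -sumEFin; congr (_ * _)%E.
rewrite /event_condexp [X in (X * _)%E = _]pE [X in _ / fine X]pE.
rewrite integral_empirical//.
by apply: measurable_funTS; apply: measurable_funB => //; exact: measurable_label.
Qed.

Lemma BinECE_cst alpha k (I : 'I_k -> set R) a y : bins I -> 0 <= a <= 1 ->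
  BinECE alpha I (empirical (fun=> a) y) = (`|a - meanb y| `^ alpha)%:E.
Proof.
move=> bI a01; rewrite BinECE_empirical//; congr EFin.
(* Spreading the right-hand side over the bins allows a comparison term by term: a bin without [a]
   has mass 0, the one with [a] has mass 1. *)
rewrite -[RHS]mul1r -(sum_bins_indic bI a01) mulr_suml; apply: eq_bigr => i _.
rewrite /bin_mass /bin_error mean_cst.
have -> : mean (fun t => \1_(I i) a * (a - (y t)%:R)) =
    (a - meanb y) * \1_(I i) a.
  rewrite -[X in (X - _) * _](mean_cst a) -meanB -meanMr.
  by congr mean; apply/funext => t; rewrite mulrC.
rewrite indicE.
by case: (_ \in _); rewrite ?mul0r// divr1 mulr1 mul1r.
Qed.

Lemma mean_sum (J : finType) (F : J -> 'I_n.+1 -> R) :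
  \sum_j mean (F j) = mean (fun t => \sum_j F j t).
Proof. by rewrite /mean -mulr_sumr exchange_big. Qed.

Lemma ler_norm_mean F : `|mean F| <= mean (fun t => `|F t|).
Proof.
by rewrite /mean normrM ger0_norm ?invr_ge0// ler_pM2l ?invr_gt0// ler_norm_sum.
Qed.

Lemma ler_mean F G : (forall t, F t <= G t) -> mean F <= mean G.
Proof. by move=> FG; rewrite /mean ler_pM2l ?invr_gt0//; apply: ler_sum. Qed.

(** Finite Jensen inequality with the bin masses as weights, from the supporting line at [c]. *)
Lemma BinECE_ge alpha k (I : 'I_k -> set R) r y : 1 <= alpha -> bins I ->
    (forall t, 0 <= r t <= 1) ->
  ((`|mean r - meanb y| `^ alpha)%:E <= BinECE alpha I (empirical r y))%E.
Proof.
move=> alpha1 bI r01; rewrite BinECE_empirical// lee_fin.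
set c := `|_|.
have [l l0 tangent] := powR_tangent alpha1 (normr_ge0 _ : 0 <= c).
pose p i := bin_mass r (I i); pose e i := bin_error r y (I i).
have p0 i : 0 <= p i.
  by rewrite -(mean_cst 0); apply: ler_mean => t; rewrite indicE.
have sump : \sum_i p i = 1.
  rewrite /p /bin_mass mean_sum -[RHS](mean_cst 1).
  by congr mean; apply/funext => t; exact: sum_bins_indic.
have sume : \sum_i e i = mean r - meanb y.
  rewrite /e /bin_error mean_sum -meanB.
  congr mean; apply/funext => t.
  by rewrite -mulr_suml sum_bins_indic// mul1r.
(* Holds as [|r t - y t| <= 1]; it forces [e i = 0] on a bin of mass 0. *)
have ep i : `|e i| <= p i.
  apply: le_trans (ler_norm_mean _) (ler_mean _) => t.
  have /andP[yt0 yt1] : (0 <= (y t)%:R :> R) && ((y t)%:R <= 1 :> R).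
    by rewrite ler0n lern1 leq_b1.
  rewrite normrM indicE ger0_norm// ler_piMr//.
  by have := r01 t; rewrite ler_norml; lra.
(* Also when [p i = 0], where the quotient is 0. *)
have peE i : p i * `|e i / p i| = `|e i|.
  rewrite normrM normfV (ger0_norm (p0 i)).
  have [pi0|pi0] := eqVneq (p i) 0; last by rewrite mulrC divfK.
  by have := ep i; rewrite pi0 mul0r normr_le0 => /eqP ->; rewrite normr0.
have ce : c <= \sum_i `|e i| by rewrite /c -sume ler_norm_sum.
(* The weighted supporting lines sum to [c ^ alpha + l * (\sum_i |e i| - c)]. *)
apply: (@le_trans _ _ (\sum_i p i * (c `^ alpha + l * (`|e i / p i| - c)))).
  rewrite (eq_bigr (fun i => p i * (c `^ alpha - l * c) + l * `|e i|)).
    rewrite big_split/= -mulr_suml sump -mulr_sumr.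
    by have := ler_wpM2l l0 ce; lra.
  by move=> i _; rewrite -peE; ring.
by apply: ler_sum => i _; rewrite ler_wpM2l// tangent.
Qed.

(** * Smooth calibration error *)

(* A function in W1 is only constrained, hence only measurable, on [0, 1]. *)
Definition clamp01 (v : R) : R := Num.max 0 (Num.min v 1).

Lemma clamp01_id v : 0 <= v <= 1 -> clamp01 v = v.
Proof. by move=> /andP[v0 v1]; rewrite /clamp01 min_l// max_r. Qed.

Lemma clamp01_itv v : 0 <= clamp01 v <= 1.
Proof. by rewrite /clamp01 le_max lexx/= ge_max ler01 ge_min lexx orbT. Qed.

Lemma clamp01_dist u v : `|clamp01 u - clamp01 v| <= `|u - v|.
Proof.
have uv := ler_norm (u - v); have vu := ler_norm (v - u).
rewrite distrC in vu; rewrite /clamp01 ler_norml.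
by case: (leP u 1) => u1; case: (leP v 1) => v1; case: (leP 0 u) => u0;
  case: (leP 0 v) => v0; rewrite ?(max_r ler01); apply/andP; split; lra.
Qed.

(** Clamping does not increase distances, so the composite is 1-Lipschitz on the whole line, hence
    continuous. *)
Lemma measurable_W1_clamp01 (w : R -> R) : W1 w ->
  measurable_fun setT (w \o clamp01).
Proof.
move=> [lip _]; apply: continuous_measurable_fun => v.
apply/cvgrPdist_le => e e0; near=> u.
apply: (@le_trans _ _ `|v - u|).
  apply: le_trans (clamp01_dist v u); rewrite -[leRHS]mul1r.
  by apply: (lip (clamp01 v, clamp01 u)); split => /=; rewrite in_itv/= clamp01_itv.
by near: u; apply: cvgr_dist_le => //; exact: cvg_id.
Unshelve. all: by end_near. Qed.

Lemma smCal_integral (w : R -> R) r y : W1 w -> (forall t, 0 <= r t <= 1) ->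
  (\int[empirical r y]_(x in `[0%R, 1%R] `*` [set: bool])
     ((x.1 - x.2%:R) * w x.1)%R%:E =
   (mean (fun t => (r t - (y t)%:R) * w (r t)))%:E)%E.
Proof.
move=> W1w r01.
transitivity (\int[empirical r y]_(x in `[0%R, 1%R] `*` [set: bool])
     ((x.1 - x.2%:R) * (w \o clamp01) x.1)%R%:E)%E.
  apply: eq_integral => x; rewrite inE => -[/= + _]; rewrite in_itv/= => x01.
  by rewrite clamp01_id.
rewrite integral_empirical; last 2 first.
- exact: measurableX.
- apply: measurable_funTS; apply: measurable_funM.
    by apply: measurable_funB => //; exact: measurable_label.
  exact: measurableT_comp (measurable_W1_clamp01 W1w) measurable_fst.
rewrite /mean; congr (_ * _)%:E; apply: eq_bigr => t _ /=.
rewrite clamp01_id// indicE mem_set ?mul1r//.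
by split => //=; rewrite in_itv/= r01.
Qed.

(** Under a constant prediction a weight acts only through the number [w a], which lies in
    [[-1, 1]]. *)
Lemma smCal_cst_le a y : 0 <= a <= 1 ->
  (smCal (empirical (fun=> a) y) <= `|a - meanb y|%:E)%E.
Proof.
move=> a01; apply: ge_ereal_sup => _ [w W1w <-].
rewrite smCal_integral// meanMr meanB mean_cst -/(meanb y) lee_fin.
have [_ /(_ a)] := W1w; rewrite in_itv/= => /(_ a01) wa.
apply: le_trans (ler_norm _) _; rewrite normrM ler_piMr//.
by rewrite ler_norml.
Qed.

Lemma smCal_ge r y : (forall t, 0 <= r t <= 1) ->
  (`|mean r - meanb y|%:E <= smCal (empirical r y))%E.
Proof.
(* The sign of [mean r - meanb y], so that the constant weight [s] attains the absolute value. *)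
move=> r01; pose s : R := (-1) ^+ (mean r - meanb y < 0)%R.
have W1s : W1 (cst s).
  split=> [[u v] _|v _] /=; first by rewrite subrr normr0 mulr_ge0.
  by rewrite -ler_norml normr_sign.
apply: ereal_sup_ubound; exists (cst s) => //.
rewrite smCal_integral//; congr EFin.
by rewrite meanMr meanB -/(meanb y) mulrC -normrEsign.
Qed.

(** * Lower distance to calibration *)

(** The image of a distribution of [(v, y)] under this map is its coupling with the constant
    [u = a]. *)
Definition graft a (x : R * bool) : R * R * bool := ((a, x.1), x.2).

Lemma measurable_graft a : measurable_fun setT (graft a).
Proof. by apply: measurable_fun_pair => //; exact: measurable_fun_pair. Qed.

HB.instance Definition _ a :=
  isMeasurableFun.Build _ _ _ _ (graft a) (measurable_graft a).

Lemma meanb_itv y : 0 <= meanb y <= 1.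
Proof.
apply/andP; split.
  by rewrite -(mean_cst 0); apply: ler_mean.
by rewrite -(mean_cst 1); apply: ler_mean => t; case: (y t).
Qed.

Lemma measurable_powR_dist alpha :
  measurable_fun setT (fun x : R * R * bool => `|x.1.1 - x.1.2| `^ alpha).
Proof.
apply: measurableT_comp (measurable_powR _) _; apply: measurableT_comp => //.
apply: measurable_funB.
  exact: measurableT_comp measurable_fst measurable_fst.
exact: measurableT_comp measurable_snd measurable_fst.
Qed.

Lemma low_distCal_cst_le alpha a y : 0 <= a <= 1 ->
  (low_distCal alpha (empirical (fun=> a) y) <=
   (`|a - meanb y| `^ alpha)%R%:E)%E.
Proof.
move=> a01; apply: ereal_inf_lbound.
exists (distribution (empirical (fun=> a) y) (graft (meanb y))); last first.
  rewrite unlock ge0_integral_distribution; last 2 first.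
  - by apply/measurable_EFinP; exact: measurable_powR_dist.
  - by move=> x; rewrite lee_fin powR_ge0.
  rewrite integralT_empirical/=.
    by rewrite -/(mean (fun=> _)) mean_cst distrC.
  exact: (measurableT_comp (measurable_powR_dist alpha) (measurable_graft _)).
split.
- apply: (@empirical_full (fun=> a) y (graft (meanb y) @^-1` _)) => t.
  by split => //=; split; rewrite /= in_itv/= ?meanb_itv.
- move=> A _; rewrite /distribution /pushforward; congr (empirical _ _ _).
  by apply/seteqP; split => -[].
(* The marginal of [(u, y)] is the empirical distribution with constant prediction [meanb y], so
   [condexp_cst] gives calibration at that point; the other values of [u] form a null set. *)
set J := distribution _ proj_uy.
have JE A : measurable A -> J A = empirical (fun=> meanb y) y A by [].
have mB : measurable (@fst R bool @^-1` [set~ meanb y]).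
  rewrite -[X in measurable X]setTI.
  by apply: measurable_fst => //; exact: measurableC.
exists (@fst R bool @^-1` [set~ meanb y]); split => //.
- apply: etrans (JE _ mB) _.
  rewrite /empirical big1 ?mule0// => t _.
  by rewrite diracE memNset//= => /(_ erefl).
- move=> x /= xJ; apply: contra_not xJ => ->.
  exact: condexp_cst.
Qed.

(** For any coupling [E v = mean r], while calibration gives [E u = E y = meanb y]; Jensen then
    applies to [u - v]. *)
Lemma low_distCal_ge alpha r y : 1 <= alpha ->
  ((`|mean r - meanb y| `^ alpha)%R%:E <=
   low_distCal alpha (empirical r y))%E.
Proof.
move=> alpha1; apply: le_ereal_inf_tmp => _ [Pi [_ vyE ucal] <-].
set Juy := distribution Pi proj_uy in ucal.
set Jvy := distribution Pi proj_vy in vyE.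
have m1 : measurable_fun setT (@fst R bool) by exact: measurable_fst.
pose lab (x : R * bool) : R := x.2%:R.
have mlab : measurable_fun setT lab by exact: measurable_label.
have Jvy_int f : measurable_fun setT f ->
    Pi.-integrable setT (EFin \o (f \o proj_vy)) /\
    (\int[Pi]_x (f (proj_vy x))%:E = (mean (fun t => f (r t, y t)))%:E)%E.
  move=> mf; have fi : Jvy.-integrable setT (EFin \o f).
    have /integrableP[mEf foo] := integrable_empirical r y mf.
    apply/integrableP; split => //.
    by rewrite (eq_measure_integral (empirical r y))// => A mA _; exact: vyE.
  split; first exact: integrable_distribution.
  rewrite (integral_distribution_EFin mf fi) -integralT_empirical//.
  by apply: eq_measure_integral => A mA _; exact: vyE.
have [mg gi gE] := condexpP Juy.
have mg1 : measurable_fun setT (fun x : R * bool => condexp Juy x.1).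
  exact: measurableT_comp mg measurable_fst.
(* Calibration identifies [u] almost everywhere with [condexp Juy u], from which it inherits
   integrability and expectation. *)
have gu : ae_eq Juy setT (fun x : R * bool => (condexp Juy x.1)%:E)
    (fun x => x.1%:E).
  by apply: filterS ucal => x /= -> _.
have ui : Juy.-integrable setT (EFin \o fst).
  have /integrableP[mEg goo] := gi.
  apply/integrableP; split; first exact/measurable_EFinP.
  rewrite (ae_eq_integral (fun x : R * bool => `|(condexp Juy x.1)%:E|%E))//.
  - by apply: measurableT_comp => //; exact/measurable_EFinP.
  - by apply: measurableT_comp.
  - by apply: filterS ucal => x /= -> _.
have uPi := integrable_distribution m1 ui.
have [vPi vE] := Jvy_int _ m1.
have [labPi labE] := Jvy_int _ mlab.
have uE : (\int[Pi]_x (x.1.1)%:E = (meanb y)%:E)%E.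
  rewrite -[RHS]labE (integral_distribution_EFin m1 ui).
  rewrite -(ae_eq_integral _ _ _ _ _ gu)//; last 2 first.
  - exact/measurable_EFinP.
  - exact/measurable_EFinP.
  have := gE setT measurableT; rewrite preimage_setT => ->.
  have mElab : measurable_fun setT (EFin \o lab) by exact/measurable_EFinP.
  (* Both projections keep the label [y], so the integrability obtained through [proj_vy] is
     literally the one required for [proj_uy]. *)
  have labPi' : Pi.-integrable setT ((EFin \o lab) \o proj_uy) by [].
  exact: (integral_distribution mElab labPi').
have iX : Pi.-integrable setT (EFin \o (fun x => x.1.1 - x.1.2)).
  exact: integrableB uPi vPi.
apply: le_trans (powR_norm_expectation_le alpha1 iX).
rewrite unlock (integralB_EFin _ uPi vPi)// uE vE /=.
by rewrite distrC.
Qed.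

End expectations.

Theorem theoremA2 (R : realType)
    (CAL : probability (R * bool)%type R -> \bar R)
    (hCAL : calibration_measure CAL)
    (n : nat) (r : 'I_n.+1 -> R) (y : 'I_n.+1 -> bool)
    (hr : forall t, 0 <= r t <= 1) :
  let rbar := n.+1%:R^-1 * \sum_(t < n.+1) r t in
  (CAL (empirical (fun=> rbar) y) <= CAL (empirical r y))%E.
Proof.
move=> /=; rewrite -/(mean r).
(* The averaged prediction must stay in the unit interval, where the bins cover it, the weights are
   bounded and couplings live. *)
have r01 : 0 <= mean r <= 1.
  apply/andP; split.
    by rewrite -(@mean_cst _ n 0); apply: ler_mean => t; case/andP: (hr t).
  by rewrite -(@mean_cst _ n 1); apply: ler_mean => t; case/andP: (hr t).
case: hCAL => [alpha alpha1|alpha k I alpha1 bI||alpha alpha1].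
- by rewrite ECE_cst; exact: ECE_ge.
- by rewrite BinECE_cst//; exact: BinECE_ge.
- exact: le_trans (smCal_cst_le y r01) (smCal_ge y hr).
- exact: le_trans (low_distCal_cst_le _ y r01) (low_distCal_ge r y alpha1).
Qed.
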